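(* Let $p$ be a large prime number, let $g\ge 2$ be an integer of multiplicative order $t$ modulo $p$, let $a,K,L$ be integers, and let $M$ be an integer with $1\le M<t$. Then the following bound holds: $$J_a(M;K,L)<\bigl(1+Mp^{-1/8}\bigr)M^{1/3+o(1)}.$$
   Context: $J_a(M;K,L)$ denotes the number of solutions in integers $(x,y)$ of the congruence $y\equiv a g^x\pmod p$ with $x\in[K+1,K+M]$ and $y\in[L+1,L+M]$ (for negative $x$, $g^x$ is read via the inverse of $g$ modulo $p$). The notation $B^{o(1)}$ denotes a quantity such that for any $\varepsilon>0$ there exists $c=c(\varepsilon)>0$ with $B^{o(1)}<cB^{\varepsilon}$; $M^{1/3+o(1)}$ means $M^{1/3}\cdot M^{o(1)}$.
   Formalization: The condition that p does not divide a is added; without it the bound fails, e.g. for a = 0, K = 0, L = -1, g a primitive root and M = floor(p^{1/8}), where y = 0 is a solution for every x, so J is at least M. *)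

(* Defs.v *)
From mathcomp Require Import all_boot all_order all_algebra.

Set Implicit Arguments.
Unset Strict Implicit.
Unset Printing Implicit Defensive.

Import GRing.Theory.
Local Open Scope ring_scope.

(* The number of pairs (x, y) in [K+1, K+M] x [L+1, L+M] such that
   y = a g^x (mod p).  The pair (i, j) of ordinals stands for
   x = K + (i + 1), y = L + (j + 1).  The exponent is an integer: for x < 0,
   g ^ x is a power of the inverse of g in 'F_p.  Only meaningful for p prime,
   since 'F_p is the field with (pdiv p) elements. *)
Definition expCongrCount (p : nat) (g a : int) (M : nat) (K L : int) : nat :=
  #|[set ij : 'I_M * 'I_M |
      (L + ij.2.+1%:Z)%:~R == a%:~R * (g%:~R : 'F_p) ^ (K + ij.1.+1%:Z)]|.

(* Main.v *)
(* Write the solutions as pairs (x, y) and cut the range of y into blocks of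
   length h, where 144 h ^ 8 < p. If a block contains Z solutions, then among
   the Z ^ 3 triples of solutions one value of x1 + x2 + x3 occurs at least
   Z ^ 3 / (3 M) times, and for these triples y1 y2 y3 is a fixed nonzero residue.
   Hence it suffices to show that (s + x1)(s + x2)(s + x3) = lam has few
   solutions in 'F_p with 0 <= x1, x2, x3 < h.

   Subtracting a fixed solution y from a solution x gives an integer polynomial
   P_x of degree at most 2 having s as a root modulo p. The resultant of two such
   polynomials is divisible by p and at most 144 h ^ 8 in absolute value, so it
   vanishes. Fix one P = P_z. Either P_x is proportional to P, and then the
   product of the P (- x_i), being a resultant of P and a cubic, is the same for
   x and y; or P_x and P share exactly one root, which is rational and equal to
   - b / a for one of at most two values of b / a, and then the product of
   the a x_i - b is the same for x and y. When x and y have no common coordinate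
   this product is a nonzero integer, polynomially bounded in h, so the divisor
   bound leaves few possibilities for each x_i. Common coordinates lead to the
   same problem with two factors, where the P_x are linear. *)
Require Import Defs.
From mathcomp Require Import all_boot all_order all_algebra.
From mathcomp Require Import reals exp.
From mathcomp Require Import ring lra zify.

Set Implicit Arguments.
Unset Strict Implicit.
Unset Printing Implicit Defensive.

Import Order.TTheory GRing.Theory Num.Theory.
Local Open Scope ring_scope.

(** * Divisor bound and finite counting *)

Lemma size_divisors n :
  size (divisors n) = (\prod_(f <- prime_decomp n) f.2.+1)%N.
Proof.
rewrite /divisors; elim: (prime_decomp n) => [|[q e] s IHs] /=.
  by rewrite big_nil.
rewrite big_cons -IHs /=; elim: e => [|e IHe] /=; first by rewrite mul1n.
by rewrite size_merge size_cat size_map IHe mulSn addnC.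
Qed.

Lemma leq_expn2r k m n : (m <= n)%N -> (m ^ k <= n ^ k)%N.
Proof. by case: k => // k; rewrite leq_exp2r. Qed.

(** Raise [e + 1 <= k * (e %/ k + 1) <= k * 2 ^ (e %/ k)] to the power [k]. *)
Lemma succ_exp_le k e : (e.+1 ^ k <= k ^ k * 2 ^ e)%N.
Proof.
case: (posnP k) => [-> | k_gt0]; first by rewrite !expn0 mul1n expn_gt0.
apply: (@leq_trans ((k * 2 ^ (e %/ k)) ^ k)%N).
  apply/leq_expn2r/(@leq_trans ((e %/ k).+1 * k)); first exact: ltn_ceil.
  by rewrite mulnC leq_mul2l ltn_expl ?orbT.
by rewrite expnMn -expnM leq_mul2l leq_exp2l // leq_divM orbT.
Qed.

(** The bound [d(n) <= C n ^ (1 / k)] in integer form. A prime [q >= 2 ^ k] of exponent [e]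
    contributes [(e + 1) ^ k <= 2 ^ (k e) <= q ^ e]; each of the at most [2 ^ k] smaller primes
    costs a factor [k ^ k]. *)
Lemma divisors_bound k :
  exists2 c : nat, (0 < c)%N &
    forall n, (0 < n)%N -> (size (divisors n) ^ k <= c * n)%N.
Proof.
pose c0 := (k ^ k)%N.
have c0_gt0 : (0 < c0)%N by rewrite /c0; case: (k) => // k'; rewrite expn_gt0.
exists (c0 ^ (2 ^ k))%N => [|n n_gt0]; first by rewrite expn_gt0 c0_gt0.
have factor_le q e : (1 < q)%N ->
    (e.+1 ^ k <= (if (q < 2 ^ k)%N then c0 else 1) * q ^ e)%N.
  move=> q_gt1; case: ltnP => [_|le_q].
    by apply: leq_trans (succ_exp_le k e) _; rewrite leq_mul2l leq_expn2r ?orbT.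
  rewrite mul1n; apply: (@leq_trans ((2 ^ e) ^ k)%N).
    by rewrite leq_expn2r // ltn_expl.
  by rewrite -expnM mulnC expnM leq_expn2r.
rewrite size_divisors [in leqRHS](prod_prime_decomp n_gt0) prime_decompE.
rewrite 2!(big_map (fun q => (q, logn q n))) /=.
rewrite (big_morph (fun m => m ^ k)%N (fun m n => expnMn m n k) (exp1n k)).
apply: (@leq_trans (\prod_(q <- primes n)
   ((if (q < 2 ^ k)%N then c0 else 1) * q ^ logn q n))%N).
  rewrite !big_seq; apply: leq_prod => q; rewrite mem_primes.
  case/andP=> /prime_gt1 q1 _.
  exact: factor_le q1.
rewrite big_split leq_mul2r -big_mkcond /=; apply/orP; right.
rewrite big_const_seq iter_muln_1 leq_pexp2l // -size_filter.
rewrite -[leqRHS](size_iota 0).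
apply: uniq_leq_size => [|q]; first by rewrite filter_uniq ?primes_uniq.
by rewrite mem_filter mem_iota => /andP[].
Qed.

Lemma card_le_fibres (T : finType) (V : eqType) (A : {set T}) (f : T -> V)
    (s : seq V) m :
    {in A, forall x, f x \in s} ->
    {in s, forall v, #|[set x in A | f x == v]| <= m}%N ->
  (#|A| <= size s * m)%N.
Proof.
elim: s A => [|v s IHs] A fA fm.
  suff -> : A = set0 by rewrite cards0.
  by apply/setP=> x; rewrite inE; apply/negP => /fA.
rewrite /= mulSn -(cardsID [set x | f x == v] A) leq_add //.
  by rewrite -setIdE fm ?mem_head.
apply: IHs => [x | w ws].
  by rewrite !inE => /andP[/negPf fxv /fA]; rewrite inE fxv.
apply: leq_trans (fm w _); last by rewrite inE ws orbT.
by apply/subset_leq_card/subsetP => x; rewrite !inE => /andP[/andP[_ ->]].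
Qed.

Lemma card_le_inj (T U : finType) (A : {set T}) (B : {set U}) (f : T -> U) :
    {in A, forall x, f x \in B} -> {in A &, injective f} ->
  (#|A| <= #|B|)%N.
Proof.
move=> fA inj_f; rewrite -(card_in_imset inj_f); apply/subset_leq_card/subsetP.
by move=> _ /imsetP[x Ax ->]; apply: fA.
Qed.

Lemma quadratic_roots_le (F : idomainType) (A B C : F) (rs : seq F) :
    [|| A != 0, B != 0 | C != 0] -> uniq rs ->
    {in rs, forall r, A * r ^+ 2 + B * r + C = 0} ->
  (size rs <= 2)%N.
Proof.
move=> ABC Urs rs0; pose q : {poly F} := Poly [:: C; B; A].
have q_n0 : q != 0.
  apply/eqP => q0; have coef i : q`_i = 0 by rewrite q0 coef0.
  move: (coef 0%N) (coef 1%N) (coef 2%N) ABC; rewrite !coef_Poly /= => -> -> ->.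
  by rewrite eqxx.
have rq : all (root q) rs.
  apply/allP => r /rs0 r0; rewrite /root horner_Poly /=.
  by rewrite -[X in _ == X]r0; apply/eqP; ring.
rewrite -ltnS; apply: leq_trans (max_poly_roots q_n0 rq Urs) _.
exact: leq_trans (size_Poly _) _.
Qed.

(** Turns congruences into equalities: a multiple of [p] below [p] in absolute value is zero. *)
Lemma intr_pchar_eq0 (F : nzRingType) p (n : int) :
  p \in [pchar F] -> n%:~R = 0 :> F -> `|n| < p%:Z -> n = 0.
Proof.
move=> charF n0 lt_np; apply/eqP/negPn/negP => n_n0.
have : (p %| `|n|)%N by rewrite -[p]/`|p%:Z|%N -dvdzE (dvdz_pcharf charF) n0.
by move/dvdn_leq; lia.
Qed.

Lemma natr_ord_inj (F : nzRingType) p h :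
  p \in [pchar F] -> (h <= p)%N -> injective (fun i : 'I_h => i%:R : F).
Proof.
move=> charF le_hp i j /= eq_ij; apply/val_inj/eqP; rewrite -eqz_nat -subr_eq0.
apply/eqP/(intr_pchar_eq0 charF); first by rewrite rmorphB /= -!pmulrn eq_ij subrr.
by rewrite /=; have := ltn_ord i; have := ltn_ord j; lia.
Qed.

Lemma card_quadratic_eq (A B C v : int) h : (A != 0) || (B != 0) ->
  (#|[set i : 'I_h | (A * i%:Z ^+ 2 + B * i%:Z + C == v)%R]| <= 2)%N.
Proof.
move=> AB; rewrite cardE -(size_map (fun i : 'I_h => i%:Z)).
apply: (@quadratic_roots_le _ A B (C - v)).
- by case/orP: AB => ->; rewrite ?orbT.
- by rewrite map_inj_uniq ?enum_uniq // => i j [] /val_inj.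
move=> _ /mapP[i + ->]; rewrite mem_enum inE => /eqP <-; ring.
Qed.

(** [N] has at most [2 * D] divisors counted with sign, and a nonconstant polynomial of degree at
    most 2 takes each value at most twice. *)
Lemma card_quadratic_dvd (A B C N : int) h D : (A != 0) || (B != 0) -> N != 0 ->
    (size (divisors `|N|) <= D)%N ->
  (#|[set i : 'I_h | (A * i%:Z ^+ 2 + B * i%:Z + C %| N)%Z]| <= 4 * D)%N.
Proof.
move=> AB N0 leD; set V := [set i | _].
pose s := [seq d%:Z | d <- divisors `|N|] ++ [seq - d%:Z | d <- divisors `|N|].
pose q (i : 'I_h) := A * i%:Z ^+ 2 + B * i%:Z + C.
apply: (@leq_trans (size s * 2)); last by rewrite size_cat !size_map; lia.
apply: (@card_le_fibres _ _ V q) => [i | v _].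
  rewrite inE -/(q i) dvdzE dvdn_divisors ?absz_gt0 // => qi.
  rewrite mem_cat; case: (lerP 0 (q i)) => q0.
    by apply/orP; left; apply/mapP; exists `|q i|%N => //; lia.
  by apply/orP; right; apply/mapP; exists `|q i|%N => //; lia.
apply: leq_trans (card_quadratic_eq C v h AB); apply/subset_leq_card/subsetP=> i.
by rewrite !inE => /andP[].
Qed.

Lemma ler_norm_minor (a b c d u v : int) :
  `|a| <= u -> `|b| <= v -> `|c| <= u -> `|d| <= v ->
  `|a * b - c * d| <= 2 * (u * v).
Proof.
move=> ha hb hc hd; apply: le_trans (ler_normB _ _) _.
rewrite !normrM mulr2n mulrDl mul1r.
by apply: lerD; apply: ler_pM.
Qed.

(** Every factor divides [N], so each coordinate lies in a set of at most [4 * D] indices. *)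
Lemma card_triples_dvd (A B C N : int) h D (q : 'I_h -> int)
    (T : {set 'I_h * 'I_h * 'I_h}) :
    (A != 0) || (B != 0) -> N != 0 -> (size (divisors `|N|) <= D)%N ->
    (forall i, q i = A * i%:Z ^+ 2 + B * i%:Z + C) ->
    {in T, forall x, q x.1.1 * q x.1.2 * q x.2 = N} ->
  (#|T| <= (4 * D) ^ 3)%N.
Proof.
move=> AB N0 leD qE TN.
have /= V_le := card_quadratic_dvd C h AB N0 leD; set V := [set i | _] in V_le.
apply: (@leq_trans #|setX (setX V V) V|); last first.
  by rewrite !cardsX expnSr -mulnn !leq_mul.
apply/subset_leq_card/subsetP => x /TN eN.
rewrite !inE -!qE -eN -andbA; apply/and3P; split.
- exact/dvdz_mulr/dvdz_mulr/dvdzz.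
- exact/dvdz_mulr/dvdz_mull/dvdzz.
- exact/dvdz_mull/dvdzz.
Qed.

(** * Pairs of quadratics with a common root modulo p *)

(* The quantity b ^ 2 - a c is the resultant of the two quadratics. *)
Lemma common_root_minors (F : fieldType) p h (s : F) (A B C A' B' C' : int) :
    p \in [pchar F] -> (144 * h ^ 8 < p)%N ->
    A%:~R * s ^+ 2 + B%:~R * s + C%:~R = 0 ->
    A'%:~R * s ^+ 2 + B'%:~R * s + C'%:~R = 0 ->
    `|A| <= 3 * h%:Z -> `|B| <= 3 * h%:Z ^+ 2 -> `|C| <= h%:Z ^+ 3 ->
    `|A'| <= 3 * h%:Z -> `|B'| <= 3 * h%:Z ^+ 2 -> `|C'| <= h%:Z ^+ 3 ->
  let a := A * B' - A' * B in
  let b := A * C' - A' * C in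
  let c := B * C' - B' * C in
  b ^+ 2 = a * c /\ (A = 0 -> A' = 0 -> c = 0).
Proof.
move=> charF lt_hp r r' hA hB hC hA' hB' hC' a b c.
have ha := ler_norm_minor hA hB' hA' hB.
have hb := ler_norm_minor hA hC' hA' hC.
have hc := ler_norm_minor hB hC' hB' hC.
rewrite -/a -/b -/c in ha hb hc.
have rab : a%:~R * s + b%:~R = 0 :> F.
  transitivity (A%:~R * (A'%:~R * s ^+ 2 + B'%:~R * s + C'%:~R) -
    A'%:~R * (A%:~R * s ^+ 2 + B%:~R * s + C%:~R) : F); first by rewrite /a /b; ring.
  by rewrite r r' !mulr0 subrr.
have rbc : b%:~R * s + c%:~R = 0 :> F.
  transitivity (B%:~R * (A'%:~R * s ^+ 2 + B'%:~R * s + C'%:~R) -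
    B'%:~R * (A%:~R * s ^+ 2 + B%:~R * s + C%:~R) +
    s * (a%:~R * s + b%:~R) : F); first by rewrite /a /b /c; ring.
  by rewrite r r' rab !mulr0 subrr addr0.
split.
  apply/eqP; rewrite -subr_eq0; apply/eqP; rewrite expr2.
  apply: (intr_pchar_eq0 charF).
    transitivity (b%:~R * (a%:~R * s + b%:~R) - a%:~R * (b%:~R * s + c%:~R) : F).
      by ring.
    by rewrite rab rbc !mulr0 subrr.
  apply: le_lt_trans (ler_normB _ _) _; rewrite !normrM.
  have h1 := ler_pM (normr_ge0 b) (normr_ge0 b) hb hb.
  have h2 := ler_pM (normr_ge0 a) (normr_ge0 c) ha hc.
  apply: le_lt_trans (lerD h1 h2) _.
  (* The two terms are at most [36 h ^ 8] and [108 h ^ 8]. *)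
  by rewrite (_ : _ + _ = (144 * h ^ 8)%N%:Z) // !PoszM; lia.
(* For two linear polynomials [b ^ 2 = a c] is empty, but [c] itself vanishes modulo [p], and
   [|c| <= 6 h ^ 5]. *)
move=> A0 A'0; apply: (intr_pchar_eq0 charF).
  have b0 : b = 0 by rewrite /b A0 A'0; ring.
  by move: rbc; rewrite b0 mul0r add0r.
apply: le_lt_trans hc _.
apply: (@le_lt_trans _ _ (6 * h ^ 5)%N%:Z); first by lia.
by rewrite ltz_nat; apply: leq_ltn_trans lt_hp; case: (h) => // n;
  rewrite leq_mul // leq_pexp2l.
Qed.

(** If [a = 0] then [b = 0], and the identities [A c = B b - C a] and [A' c = B' b - C' a] leave
    [c = 0] or [A = A' = 0]. So either the two quadratics are linearly dependent, or [a <> 0] and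
    [- b / a] is a common root. *)
Lemma minors_dichotomy (A B C A' B' C' : int) :
  let a := A * B' - A' * B in
  let b := A * C' - A' * C in
  let c := B * C' - B' * C in
  b ^+ 2 = a * c -> (A = 0 -> A' = 0 -> c = 0) ->
  [&& a == 0, b == 0 & c == 0] || (a != 0).
Proof.
move=> a b c bac A0c; have [a0 /=|//] := eqVneq a 0; rewrite orbF.
have b0 : b = 0 by apply/eqP; rewrite -sqrf_eq0 bac a0 mul0r.
rewrite b0 eqxx /=; apply/negPn/negP => c0.
have eA : A * c = 0.
  by transitivity (B * b - C * a); [rewrite /a /b /c; ring | rewrite a0 b0; ring].
have eA' : A' * c = 0.
  by transitivity (B' * b - C' * a); [rewrite /a /b /c; ring | rewrite a0 b0; ring].
have AA : A = 0 by apply/eqP; move/eqP: eA; rewrite mulf_eq0 (negPf c0) orbF.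
have AA' : A' = 0 by apply/eqP; move/eqP: eA'; rewrite mulf_eq0 (negPf c0) orbF.
by rewrite A0c // eqxx in c0.
Qed.

(* Both sides are the resultant of A X^2 + B X + C and of a monic cubic, and
   the two cubics differ by a multiple of the quadratic. *)
Lemma prod_quadratic_eq (A B C x1 x2 x3 y1 y2 y3 : int) :
  let q i := A * i ^+ 2 + - B * i + C in
  let A' := x1 + x2 + x3 - (y1 + y2 + y3) in
  let B' := x1 * x2 + x1 * x3 + x2 * x3 - (y1 * y2 + y1 * y3 + y2 * y3) in
  let C' := x1 * x2 * x3 - y1 * y2 * y3 in
  (A != 0) || (B != 0) -> A * B' - A' * B = 0 -> A * C' - A' * C = 0 ->
  B * C' - B' * C = 0 -> q x1 * q x2 * q x3 = q y1 * q y2 * q y3.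
Proof.
move=> q A' B' C' AB a0 b0 c0.
(* The resultant of [A X^2 + B X + C] and [e0 X^3 + e1 X^2 + e2 X + e3], written out. *)
pose R (e0 e1 e2 e3 : int) := A ^+ 3 * e3 ^+ 2 - A ^+ 2 * B * e2 * e3 +
  A ^+ 2 * C * (e2 ^+ 2 - 2 * e1 * e3) + A * B ^+ 2 * e1 * e3 -
  A * B * C * (e1 * e2 - 3 * e0 * e3) + A * C ^+ 2 * (e1 ^+ 2 - 2 * e0 * e2) -
  B ^+ 3 * e0 * e3 + B ^+ 2 * C * e0 * e2 - B * C ^+ 2 * e0 * e1 + C ^+ 3 * e0 ^+ 2.
(* Proportionality without division: [m] is [A] or [B], whichever is nonzero, and becomes the
   leading coefficient of both cubics. *)
have [m [k [m0 mA mB mC]]] : exists m k,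
    [/\ m != 0, m * A' = k * A, m * B' = k * B & m * C' = k * C].
  case/orP: AB => [A0|B0].
    by exists A, A'; split=> //;
      [rewrite mulrC | apply/eqP; rewrite -subr_eq0; apply/eqP..].
  exists B, B'; split=> //;
    [| by rewrite mulrC | by apply/eqP; rewrite -subr_eq0; apply/eqP].
  by apply/eqP; rewrite -subr_eq0 -oppr_eq0; apply/eqP; rewrite -[RHS]a0; ring.
have prodE z1 z2 z3 : m ^+ 2 * (q z1 * q z2 * q z3) =
    R m (m * (z1 + z2 + z3)) (m * (z1 * z2 + z1 * z3 + z2 * z3)) (m * (z1 * z2 * z3)).
  by rewrite /R /q; ring.
apply: (@mulfI _ (m ^+ 2)); first by rewrite expf_neq0.
rewrite !prodE.
rewrite (_ : m * (x1 + _ + _) = m * (y1 + y2 + y3) + k * A); last by rewrite -mA /A'; ring.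
rewrite (_ : m * (x1 * _ + _ + _) = m * (y1 * y2 + y1 * y3 + y2 * y3) + k * B); last first.
  by rewrite -mB /B'; ring.
rewrite (_ : m * (x1 * _ * _) = m * (y1 * y2 * y3) + k * C); last by rewrite -mC /C'; ring.
by rewrite /R; ring.
Qed.

(* When a <> 0, the hypothesis says that - b / a is a common root of the two
   quadratics. *)
Lemma prod_linear_eq (A B C x1 x2 x3 y1 y2 y3 : int) :
  let A' := x1 + x2 + x3 - (y1 + y2 + y3) in
  let B' := x1 * x2 + x1 * x3 + x2 * x3 - (y1 * y2 + y1 * y3 + y2 * y3) in
  let C' := x1 * x2 * x3 - y1 * y2 * y3 in
  let a := A * B' - A' * B in
  let b := A * C' - A' * C in
  let c := B * C' - B' * C in
  b ^+ 2 = a * c ->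
  (a * x1 - b) * (a * x2 - b) * (a * x3 - b) =
  (a * y1 - b) * (a * y2 - b) * (a * y3 - b).
Proof.
move=> A' B' C' a b c bac; apply/eqP; rewrite -subr_eq0; apply/eqP.
transitivity (A' * (a * b ^+ 2) - B' * a ^+ 2 * b + C' * a ^+ 3).
  by move: (a) (b) => u v; rewrite /A' /B' /C'; ring.
rewrite bac; transitivity (a ^+ 2 * (A' * c - B' * b + C' * a)); first by ring.
(* The second factor is, up to sign, a 3 by 3 determinant with two equal rows. *)
by apply/eqP; rewrite mulf_eq0; apply/orP; right; apply/eqP; rewrite /a /b /c; ring.
Qed.

(** * Products of shifted small integers *)

(** The two-factor problem, met when a triple shares a coordinate with the fixed one. Here [s] is a
    root modulo [p] of each linear [B x X + C x]; the minors of these are at most [4 h ^ 3 < p], so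
    they vanish and the polynomials are proportional. *)
Lemma sol2_bound (F : fieldType) p h D (s lam : F) :
    p \in [pchar F] -> (4 * h ^ 3 < p)%N -> lam != 0 ->
    (forall n, 0 < n <= 9 * h ^ 4 -> size (divisors n) <= D)%N ->
  (#|[set x : 'I_h * 'I_h | ((s + x.1%:R) * (s + x.2%:R) == lam)%R]|
    <= 18 * D ^ 2)%N.
Proof.
move=> charF lt_hp lam0 hD; set S := [set x | _].
case: (set_0Vmem S) => [->|[[y1 y2] Sy]]; first by rewrite cards0.
have h_gt0 : (0 < h)%N by apply: leq_ltn_trans (ltn_ord y1).
have D_gt0 : (0 < D)%N by apply: (hD 1%N); lia.
have natr_inj : injective (fun i : 'I_h => i%:R : F).
  by apply: natr_ord_inj charF _; nia.
have SE x : x \in S -> (s + x.1%:R) * (s + x.2%:R) = lam by rewrite inE => /eqP.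
have S_neq0 x : x \in S -> s + x.1%:R != 0 /\ s + x.2%:R != 0.
  by move/SE => e; move: lam0; rewrite -e mulf_eq0 negb_or => /andP.
pose sh := [set x : 'I_h * 'I_h | (x.1 \in [:: y1; y2]) || (x.2 \in [:: y1; y2])].
rewrite -(cardsID sh S).
(* The first term covers solutions sharing a coordinate with [y]: only [y] and its swap. *)
have -> : (18 * D ^ 2 = 2 * D ^ 2 + (4 * D) ^ 2)%N by lia.
apply: leq_add.
  apply: (@leq_trans 2); last first.
    by rewrite -[X in (X <= _)%N]muln1 leq_mul2l expn_gt0 D_gt0.
  apply: (@leq_trans #|[set (y1, y2); (y2, y1)]|); last first.
    by rewrite cards2; case: (_ != _).
  apply/subset_leq_card/subsetP => -[x1 x2]; rewrite in_setI => /andP[Sx].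
  have := SE _ Sx; rewrite -(SE _ Sy); have [] := S_neq0 _ Sx.
  have [] := S_neq0 _ Sy.
  rewrite !inE /= => hy1 hy2 hx1 hx2 e.
  have cancel (u v w : 'I_h) : s + u%:R != 0 ->
    (s + u%:R) * (s + v%:R) = (s + u%:R) * (s + w%:R) -> v = w.
    by move=> hu /(mulfI hu)/addrI/natr_inj.
  case/orP=> /orP[] /eqP exy; subst x1 || subst x2.
  - by rewrite (cancel _ _ _ hy1 e) eqxx.
  - by rewrite (cancel y2 x2 y1) ?eqxx ?orbT // e mulrC.
  - by rewrite (cancel y1 x1 y2) ?eqxx ?orbT // -e mulrC.
  - by rewrite (cancel y2 x1 y1) ?eqxx // mulrC e mulrC.
case: (set_0Vmem (S :\: sh)) => [->|[z]]; first by rewrite cards0.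
pose B (x : 'I_h * 'I_h) : int := x.1%:Z + x.2%:Z - (y1%:Z + y2%:Z).
pose C (x : 'I_h * 'I_h) : int := x.1%:Z * x.2%:Z - y1%:Z * y2%:Z.
have B_le x : `|B x| <= 2 * h%:Z.
  rewrite /B; have := ltn_ord x.1; have := ltn_ord x.2.
  have := ltn_ord y1; have := ltn_ord y2; lia.
have C_le x : `|C x| <= h%:Z ^+ 2.
  rewrite /C; have := ltn_ord x.1; have := ltn_ord x.2.
  have := ltn_ord y1; have := ltn_ord y2; nia.
have root_s x : x \in S -> (B x)%:~R * s + (C x)%:~R = 0 :> F.
  move=> Sx; transitivity ((s + x.1%:R) * (s + x.2%:R) - (s + y1%:R) * (s + y2%:R)).
    by rewrite /B /C /=; ring.
  by rewrite (SE x) // (SE _ Sy) subrr.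
have minor0 x x' : x \in S -> x' \in S -> B x * C x' - B x' * C x = 0.
  move=> /root_s rx /root_s rx'; apply: (intr_pchar_eq0 charF).
    transitivity ((B x)%:~R * ((B x')%:~R * s + (C x')%:~R) -
      (B x')%:~R * ((B x)%:~R * s + (C x)%:~R) : F); first by ring.
    by rewrite rx rx' !mulr0 subrr.
  apply: le_lt_trans (ler_norm_minor (B_le x) (C_le x') (B_le x') (C_le x)) _.
  rewrite (_ : 2 * _ = (4 * h ^ 3)%N%:Z) //; lia.
have Sz_neq0 v : z \in S :\: sh -> v \in [:: y1; y2] -> C z - B z * v%:Z != 0.
  rewrite in_setD inE negb_or => /andP[/andP[z1 z2] _] hv.
  have -> : C z - B z * v%:Z = (z.1%:Z - v%:Z) * (z.2%:Z - v%:Z).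
    by move: hv; rewrite /C /B !inE => /orP[] /eqP ->; ring.
  by rewrite mulf_neq0 // subr_eq0 eqz_nat; apply/negP => /eqP/val_inj e;
     [move: z1 | move: z2]; rewrite e hv.
move=> zSsh; have /setDP[Sz _] := zSsh.
have Bz0 : B z != 0.
  apply/eqP => Bz; have /eqP[] := Sz_neq0 y1 zSsh (mem_head _ _).
  rewrite Bz mul0r subr0; apply: (intr_pchar_eq0 charF).
    by have := root_s z Sz; rewrite Bz mul0r add0r.
  apply: le_lt_trans (C_le z) _; nia.
(* The product of the values of [B z X + C z] at [- y1] and [- y2]; by proportionality every
   solution [x] gives the same product. *)
pose N := (C z - B z * y1%:Z) * (C z - B z * y2%:Z).
have N0 : N != 0 by apply: mulf_neq0; apply: Sz_neq0 => //; rewrite !inE eqxx ?orbT.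
pose V := [set i : 'I_h | (0 * i%:Z ^+ 2 + - B z * i%:Z + C z %| N)%Z].
apply: (@leq_trans #|setX V V|).
  apply/subset_leq_card/subsetP => x /setDP[Sx _].
  have eN : (C z - B z * x.1%:Z) * (C z - B z * x.2%:Z) = N.
    apply/eqP; rewrite -subr_eq0.
    rewrite (_ : _ - _ = B z * (B z * C x - B x * C z)).
      by rewrite minor0 ?mulr0.
    by rewrite /N; move: (B z) (C z) => b c; rewrite /B /C /=; ring.
  rewrite !inE -eN !mul0r !add0r !(addrC (- B z * _)) !mulNr.
  by rewrite dvdz_mulr ?dvdz_mull.
have V_le : (#|V| <= 4 * D)%N.
  apply: card_quadratic_dvd => //; first by rewrite oppr_eq0 Bz0 orbT.
  apply: hD; rewrite absz_gt0 N0 /=.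
  have W_le (v : 'I_h) : `|C z - B z * v%:Z| <= 3 * h%:Z ^+ 2.
    have := C_le z; have := B_le z; have := ltn_ord v; nia.
  have : `|N| <= 3 * h%:Z ^+ 2 * (3 * h%:Z ^+ 2) by rewrite normrM ler_pM.
  lia.
by rewrite cardsX -mulnn leq_mul.
Qed.

(** The constant is [3 * 3 * 18], for the position and value of a coordinate shared with [y], plus
    [3 * 4 ^ 3], for the proportional class and at most two classes with a given common root. The
    integers factored have three factors of size at most [24 h ^ 4]. *)
Lemma sol3_bound (F : fieldType) p h D (s lam : F) :
    p \in [pchar F] -> (144 * h ^ 8 < p)%N -> lam != 0 ->
    (forall n, 0 < n <= 24 ^ 3 * h ^ 12 -> size (divisors n) <= D)%N ->
  (#|[set x : 'I_h * 'I_h * 'I_h |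
      ((s + x.1.1%:R) * (s + x.1.2%:R) * (s + x.2%:R) == lam)%R]| <= 354 * D ^ 3)%N.
Proof.
move=> charF lt_hp lam0 hD; set S := [set x | _].
case: (set_0Vmem S) => [->|[[[y1 y2] y3] Sy]]; first by rewrite cards0.
have h_gt0 : (0 < h)%N by apply: leq_ltn_trans (ltn_ord y1).
have h_pow m n : (m <= n -> h ^ m <= h ^ n)%N by move=> ?; rewrite leq_pexp2l.
have D_gt0 : (0 < D)%N by apply: (hD 1%N); rewrite /= muln_gt0 !expn_gt0 h_gt0.
have SE x : x \in S -> (s + x.1.1%:R) * (s + x.1.2%:R) * (s + x.2%:R) = lam.
  by rewrite inE => /eqP.
pose ys := [:: y1; y2; y3].
pose sh := [set x : 'I_h * 'I_h * 'I_h |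
  [|| x.1.1 \in ys, x.1.2 \in ys | x.2 \in ys]].
rewrite -(cardsID sh S).
have D23 : (D ^ 2 <= D ^ 3)%N by rewrite leq_pexp2l.
have -> : (354 * D ^ 3 = 162 * D ^ 3 + 3 * (4 * D) ^ 3)%N by lia.
apply: leq_add.
  (* With a shared coordinate [v] fixed, the other two solve the two-factor problem for
     [lam / (s + v)]; [s + v = 0] is impossible as [lam <> 0]. *)
  have fibre (co : 'I_h * 'I_h * 'I_h -> 'I_h)
      (re : 'I_h * 'I_h * 'I_h -> 'I_h * 'I_h) :
      (forall x : 'I_h * 'I_h * 'I_h,
        (s + x.1.1%:R) * (s + x.1.2%:R) * (s + x.2%:R) =
        (s + (co x)%:R) * ((s + (re x).1%:R) * (s + (re x).2%:R))) ->
      injective (fun x => (co x, re x)) ->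
      (#|[set x in S | co x \in ys]| <= 3 * (18 * D ^ 2))%N.
    move=> prodE inj_co.
    apply: (@card_le_fibres _ _ _ co ys) => [x|v _]; first by rewrite inE => /andP[].
    have [v0|v0] := eqVneq (s + v%:R) 0.
      suff -> : [set x in [set x in S | co x \in ys] | co x == v] = set0.
        by rewrite cards0.
      apply/setP => x; rewrite !inE; apply/negP => /andP[/andP[/eqP e _] /eqP co_x].
      by move: lam0; rewrite -e prodE co_x v0 mul0r eqxx.
    have lt4 : (4 * h ^ 3 < p)%N.
      by apply: leq_ltn_trans lt_hp; rewrite leq_mul // h_pow.
    have lam0' : lam / (s + v%:R) != 0 by rewrite mulf_neq0 ?invr_eq0.
    apply: leq_trans (sol2_bound s charF lt4 lam0' (D := D) _); last first.
      move=> n /andP[n0 le_n]; apply: hD; rewrite n0; apply: leq_trans le_n _.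
      by rewrite leq_mul // h_pow.
    apply: (@card_le_inj _ _ _ _ re) => [x|x x'].
      rewrite !inE => /andP[/andP[/eqP e _] /eqP co_x].
      by rewrite -e prodE co_x [X in X / _]mulrC mulfK.
    rewrite !inE => /andP[_ /eqP e] /andP[_ /eqP e'] ere.
    by apply: inj_co; rewrite /= e e' ere.
  have -> : S :&: sh = [set x in S | x.1.1 \in ys] :|: [set x in S | x.1.2 \in ys]
      :|: [set x in S | x.2 \in ys].
    by apply/setP => x; rewrite !inE; case: (_ == lam); rewrite /= ?orbF -?orbA.
  apply: leq_trans (leq_card_setU _ _) _; rewrite -(subnK (isT : 54 <= 162)%N) mulnDl.
  apply: leq_add.
    apply: leq_trans (leq_card_setU _ _) _.
    have -> : ((162 - 54) * D ^ 3 = 54 * D ^ 3 + 54 * D ^ 3)%N by lia.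
    apply: leq_add.
      apply: leq_trans (fibre _ (fun x => (x.1.2, x.2)) _ _) _ => /=; last by lia.
        by move=> x; rewrite mulrA.
      by move=> [[? ?] ?] [[? ?] ?] /= [-> -> ->].
    apply: leq_trans (fibre _ (fun x => (x.1.1, x.2)) _ _) _ => /=; last by lia.
      by move=> x; rewrite mulrCA mulrA.
    by move=> [[? ?] ?] [[? ?] ?] /= [-> -> ->].
  apply: leq_trans (fibre _ (fun x => (x.1.1, x.1.2)) _ _) _ => /=; last by lia.
    by move=> x; rewrite mulrC.
  by move=> [[? ?] ?] [[? ?] ?] /= [-> -> ->].
case: (set_0Vmem (S :\: sh)) => [->|[z zSsh]]; first by rewrite cards0.
have /setDP[Sz _] := zSsh.
pose A (x : 'I_h * 'I_h * 'I_h) : int :=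
  x.1.1%:Z + x.1.2%:Z + x.2%:Z - (y1%:Z + y2%:Z + y3%:Z).
pose B (x : 'I_h * 'I_h * 'I_h) : int :=
  x.1.1%:Z * x.1.2%:Z + x.1.1%:Z * x.2%:Z + x.1.2%:Z * x.2%:Z
  - (y1%:Z * y2%:Z + y1%:Z * y3%:Z + y2%:Z * y3%:Z).
pose C (x : 'I_h * 'I_h * 'I_h) : int :=
  x.1.1%:Z * x.1.2%:Z * x.2%:Z - y1%:Z * y2%:Z * y3%:Z.
have ltz_ord (i : 'I_h) : 0 <= i%:Z <= h%:Z by have := ltn_ord i; lia.
have mul_le (u v U V : int) : 0 <= u <= U -> 0 <= v <= V -> 0 <= u * v <= U * V.
  by move=> /andP[u0 uU] /andP[v0 vV]; rewrite mulr_ge0 // ler_pM.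
have normi_le (i : 'I_h) : `|i%:Z| <= h%:Z by have := ltz_ord i; lia.
have normi2_le (i : 'I_h) : `|i%:Z ^+ 2| <= h%:Z ^+ 2.
  by rewrite normrX lerXn2r ?nnegrE.
have h34 : h%:Z ^+ 3 <= h%:Z ^+ 4 by rewrite ler_weXn2l.
have A_le x : `|A x| <= 3 * h%:Z.
  rewrite /A; have := ltz_ord x.1.1; have := ltz_ord x.1.2; have := ltz_ord x.2.
  have := ltz_ord y1; have := ltz_ord y2; have := ltz_ord y3; lia.
have mul2_le (i j : 'I_h) : 0 <= i%:Z * j%:Z <= h%:Z ^+ 2 by apply: mul_le.
have mul3_le (i j k : 'I_h) : 0 <= i%:Z * j%:Z * k%:Z <= h%:Z ^+ 3.
  by rewrite exprSr; apply: mul_le.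
have B_le x : `|B x| <= 3 * h%:Z ^+ 2.
  rewrite /B; have := mul2_le x.1.1 x.1.2; have := mul2_le x.1.1 x.2.
  have := mul2_le x.1.2 x.2; have := mul2_le y1 y2; have := mul2_le y1 y3.
  have := mul2_le y2 y3; lia.
have C_le x : `|C x| <= h%:Z ^+ 3.
  rewrite /C; have := mul3_le x.1.1 x.1.2 x.2; have := mul3_le y1 y2 y3; lia.
have root_s x : x \in S -> (A x)%:~R * s ^+ 2 + (B x)%:~R * s + (C x)%:~R = 0 :> F.
  move=> Sx; transitivity ((s + x.1.1%:R) * (s + x.1.2%:R) * (s + x.2%:R) -
      (s + y1%:R) * (s + y2%:R) * (s + y3%:R)); first by rewrite /A /B /C; ring.
  by rewrite (SE x) // (SE _ Sy) // subrr.
pose a x := A z * B x - A x * B z.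
pose b x := A z * C x - A x * C z.
pose c x := B z * C x - B x * C z.
have bac x : x \in S -> b x ^+ 2 = a x * c x /\ (A z = 0 -> A x = 0 -> c x = 0).
  move=> Sx.
  by apply: common_root_minors charF lt_hp (root_s z Sz) (root_s x Sx) _ _ _ _ _ _.
pose q (i : 'I_h) := A z * i%:Z ^+ 2 + - B z * i%:Z + C z.
have qE : forall i, q i = A z * i%:Z ^+ 2 + - B z * i%:Z + C z by [].
have q_neq0 v : v \in ys -> q v != 0.
  have /setDP[_ zsh] := zSsh.
  move: zsh; rewrite in_set => /norP[z1 /norP[z2 z3]] hv.
  (* [q v] is the difference of the cubics of [z] and [y] at [- v], where the cubic of [y]
     vanishes. *)
  have -> : q v = (z.1.1%:Z - v%:Z) * (z.1.2%:Z - v%:Z) * (z.2%:Z - v%:Z).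
    by rewrite /q; move: hv; rewrite /C /B /A !inE => /or3P[] /eqP ->; ring.
  have neq (u : 'I_h) : u \notin ys -> u%:Z - v%:Z != 0.
    by move=> hu; rewrite subr_eq0 eqz_nat; apply: contraNneq hu => /val_inj ->.
  by apply: mulf_neq0; [apply: mulf_neq0|]; apply: neq.
have [y1s y2s y3s] : [/\ y1 \in ys, y2 \in ys & y3 \in ys].
  by rewrite !inE !eqxx ?orbT.
have AB : (A z != 0) || (B z != 0).
  apply/negPn/negP; rewrite negb_or !negbK => /andP[/eqP A0 /eqP B0].
  have /eqP[] := q_neq0 y1 y1s; rewrite /q A0 B0 oppr0 !mul0r !add0r.
  apply: (intr_pchar_eq0 charF).
    by have := root_s z Sz; rewrite A0 B0 !mul0r !add0r.
  apply: le_lt_trans (C_le z) _.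
  apply: (@le_lt_trans _ _ (1 * h ^ 3)%N%:Z); first by clear; lia.
  by rewrite ltz_nat; apply: leq_ltn_trans lt_hp; rewrite leq_mul // h_pow.
have div_le N : N != 0 ->
    `|N| <= (24 * h%:Z ^+ 4) * (24 * h%:Z ^+ 4) * (24 * h%:Z ^+ 4) ->
    (size (divisors `|N|) <= D)%N.
  move=> N0 N_le; apply: hD; rewrite absz_gt0 N0 /=.
  by rewrite -lez_nat abszE; apply: le_trans N_le _; clear; lia.
pose cl1 := [set x | [&& a x == 0, b x == 0 & c x == 0]].
rewrite -(cardsID cl1 (S :\: sh)).
have -> : (3 * (4 * D) ^ 3 = (4 * D) ^ 3 + 2 * (4 * D) ^ 3)%N by clear; lia.
apply: leq_add.
  pose N := q y1 * q y2 * q y3.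
  have N0 : N != 0 by apply: mulf_neq0; [apply: mulf_neq0|]; apply: q_neq0.
  apply: (card_triples_dvd _ N0 _ qE).
  - by rewrite oppr_eq0.
  - apply: div_le => //.
    have q_le i : `|q i| <= 24 * h%:Z ^+ 4.
      have := ler_pM (normr_ge0 _) (normr_ge0 _) (A_le z) (normi2_le i).
      have := ler_pM (normr_ge0 _) (normr_ge0 _) (B_le z) (normi_le i).
      rewrite -!normrM => hB hA; rewrite /q mulNr.
      apply: le_trans (ler_normD _ _) _.
      apply: le_trans (lerD (ler_normB _ _) (C_le z)) _.
      apply: le_trans (lerD (lerD hA hB) (lexx _)) _.
      by apply: (@le_trans _ _ (7 * h%:Z ^+ 3)); clear -h34; lia.
    by rewrite !normrM !ler_pM.
  move=> x /setIP[_]; rewrite inE => /and3P[/eqP a0 /eqP b0 /eqP c0].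
  exact: prod_quadratic_eq AB a0 b0 c0.
set T := _ :\: cl1.
have TS x : x \in T -> x \in S by case/setDP => /setDP[].
have a_neq0 x : x \in T -> a x != 0.
  move=> Tx; have [bx cx] := bac x (TS x Tx).
  by have := minors_dichotomy bx cx; have /setDP[_] := Tx; rewrite inE => /negPf ->.
(* The negative of the common rational root; as a root of [A z X^2 - B z X + C z] it takes at most
   two values. *)
pose sigma x : rat := (b x)%:~R / (a x)%:~R.
have sigma_root x : x \in T ->
    (A z)%:~R * sigma x ^+ 2 + (- B z)%:~R * sigma x + (C z)%:~R = 0.
  move=> Tx; have ax : (a x)%:~R != 0 :> rat by rewrite intr_eq0 a_neq0.
  apply: (mulfI (expf_neq0 2 ax)); rewrite mulr0.
  transitivity ((A z * b x ^+ 2 - B z * a x * b x + C z * a x ^+ 2)%:~R : rat).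
    by rewrite /sigma; field.
  apply/eqP; rewrite intr_eq0 (bac x (TS x Tx)).1; apply/eqP.
  transitivity (a x * (A z * c x - B z * b x + C z * a x)); first by ring.
  by apply/eqP; rewrite mulf_eq0; apply/orP; right; apply/eqP; rewrite /a /b /c; ring.
pose sigmas := undup [seq sigma x | x <- enum T].
apply: (@leq_trans (size sigmas * (4 * D) ^ 3)); last first.
  rewrite leq_mul2r; apply/orP; right.
  apply: (@quadratic_roots_le _ (A z)%:~R (- B z)%:~R (C z)%:~R).
  - by rewrite !intr_eq0 oppr_eq0 orbA AB.
  - exact: undup_uniq.
  by move=> r; rewrite mem_undup => /mapP[x]; rewrite mem_enum => /sigma_root + -> .
apply: (@card_le_fibres _ _ T sigma) => [x Tx | v _].
  by rewrite mem_undup map_f // mem_enum.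
set Tv := [set x in T | _].
case: (set_0Vmem Tv) => [->|[w]]; first by rewrite cards0.
rewrite inE => /andP[Tw /eqP sw]; have aw := a_neq0 w Tw.
(* The linear form of one fixed [w] serves its whole class, since [b x / a x = b w / a w] there. *)
pose l (i : 'I_h) := a w * i%:Z - b w.
have lE i : l i = 0 * i%:Z ^+ 2 + a w * i%:Z + - b w by rewrite /l; ring.
(* If [l v' = 0] then [sigma w] is the integer [v'], which would be a zero of [q]. *)
have l_neq0 v' : v' \in ys -> l v' != 0.
  move=> hv; apply/negP; rewrite subr_eq0 => /eqP e; have /eqP[] := q_neq0 v' hv.
  have sv : sigma w = v'%:Z%:~R.
    by rewrite /sigma -e rmorphM /= mulrAC divff ?mul1r // intr_eq0.
  apply/eqP; rewrite -(intr_eq0 rat) -[X in _ == X](sigma_root w Tw) sv; apply/eqP.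
  by rewrite /q; ring.
pose N := l y1 * l y2 * l y3.
have N0 : N != 0 by apply: mulf_neq0; [apply: mulf_neq0|]; apply: l_neq0.
apply: (card_triples_dvd _ N0 _ lE).
- by rewrite aw orbT.
- apply: div_le => //.
  (* From [|a w| <= 18 h ^ 3] and [|b w| <= 6 h ^ 4]. *)
  have l_le i : `|l i| <= 24 * h%:Z ^+ 4.
    have a_le := ler_norm_minor (A_le z) (B_le w) (A_le w) (B_le z).
    have b_le := ler_norm_minor (A_le z) (C_le w) (A_le w) (C_le z).
    have := ler_pM (normr_ge0 _) (normr_ge0 _) a_le (normi_le i).
    rewrite -normrM => hA; apply: le_trans (ler_normB _ _) _.
    by apply: le_trans (lerD hA b_le) _; clear; lia.
  by rewrite !normrM !ler_pM.
move=> x; rewrite inE => /andP[Tx /eqP sx]; have ax := a_neq0 x Tx.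
have eab : b x * a w = b w * a x.
  have /eqP := etrans sx (esym sw); rewrite /sigma eqr_div ?intr_eq0 //.
  by rewrite -!rmorphM eqr_int => /eqP.
have := prod_linear_eq (bac x (TS x Tx)).1; rewrite -/(a x) -/(b x) => e.
apply: (mulfI (expf_neq0 3 ax)); rewrite /N.
have lxE (i : 'I_h) : a x * l i = a w * (a x * i%:Z - b x).
  by rewrite /l mulrBr [a x * b w]mulrC -eab; ring.
have pE i j k : a x ^+ 3 * (l i * l j * l k) =
    a w ^+ 3 * ((a x * i%:Z - b x) * (a x * j%:Z - b x) * (a x * k%:Z - b x)).
  transitivity ((a x * l i) * (a x * l j) * (a x * l k)); first by ring.
  by rewrite !lxE; ring.
by rewrite !pE e.
Qed.

(** * Solutions of the exponential congruence *)

(** Triples of solutions are grouped by the sum of their [x] indices, which takes at most [3 * M]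
    values. Within a group the product of the three [y] is one nonzero residue, so the three-factor
    bound applies to the offsets in the block. *)
Lemma block_bound (p : nat) (g : int) (t : nat) (a K L : int) (M h D b : nat) :
    prime p -> t.-primitive_root (g%:~R : 'F_p) -> ~~ (p%:Z %| a)%Z -> (M < t)%N ->
    (0 < h)%N -> (144 * h ^ 8 < p)%N ->
    (forall n, 0 < n <= 24 ^ 3 * h ^ 12 -> size (divisors n) <= D)%N ->
  (#|[set ij : 'I_M * 'I_M |
      ((L + ij.2.+1%:Z)%:~R == a%:~R * (g%:~R : 'F_p) ^ (K + ij.1.+1%:Z))%R &
      ij.2 %/ h == b]| ^ 3 <= 3 * M * (354 * D ^ 3))%N.
Proof.
move=> pr_p; set z : 'F_p := g%:~R; set al : 'F_p := a%:~R.
move=> prim_z pa lt_Mt h_gt0 lt_hp hD; set Z := [set _ | _ & _].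
have charF := pchar_Fp pr_p.
have al0 : al != 0 by rewrite -(dvdz_pcharf charF).
have z0 : z != 0.
  apply/eqP => z0; have := prim_expr_order prim_z.
  rewrite z0 expr0n (gtn_eqF (prim_order_gt0 prim_z)) => /esym/eqP.
  by rewrite oner_eq0.
pose md (j : 'I_M) := Ordinal (ltn_pmod j h_gt0).
(* The first [y] of block [b]; the offset from it is the index modulo [h]. *)
pose s : 'F_p := (L + (b * h).+1%:Z)%:~R.
have ZE (x : 'I_M * 'I_M) : x \in Z -> s + (md x.2)%:R = al * z ^ (K + 1) * z ^+ x.1.
  rewrite inE => /andP[/eqP e /eqP eb].
  transitivity ((L + x.2.+1%:Z)%:~R : 'F_p).
    rewrite [in RHS](divn_eq x.2 h) eb /s /=.
    by rewrite -addnS -addSnnS PoszD; ring.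
  by rewrite e -mulrA exprnP -expfzDr // -addrA; congr (_ * _ ^ (_ + _)); lia.
pose X := setX (setX Z Z) Z.
rewrite [X in (X <= _)%N](_ : _ = #|X|); last by rewrite !cardsX; ring.
apply: (@leq_trans (size (iota 0 (3 * M)) * (354 * D ^ 3))); last first.
  by rewrite size_iota.
apply: (@card_le_fibres _ _ X (fun x => x.1.1.1 + x.1.2.1 + x.2.1)%N) => [|n _].
  move=> [[[i1 j1] [i2 j2]] [i3 j3]] _; rewrite mem_iota /=.
  have := ltn_ord i1; have := ltn_ord i2; have := ltn_ord i3; lia.
pose lam := al ^+ 3 * (z ^ (K + 1)) ^+ 3 * z ^+ n.
have lam0 : lam != 0 by rewrite !mulf_neq0 ?expf_neq0 ?expfz_neq0.
apply: leq_trans (sol3_bound s charF lt_hp lam0 hD).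
pose re (x : 'I_M * 'I_M * ('I_M * 'I_M) * ('I_M * 'I_M)) :=
  (md x.1.1.2, md x.1.2.2, md x.2.2).
(* The offset determines [y], hence the power of [z], and [M < t] then recovers the index of [x]. *)
have inj_Z (x y : 'I_M * 'I_M) : x \in Z -> y \in Z -> md x.2 = md y.2 -> x = y.
  case: x y => [x1 x2] [y1 y2] Zx Zy /= exy.
  have := congr1 (fun j : 'I_h => s + j%:R) exy.
  rewrite (ZE _ Zx) (ZE _ Zy) /= => /mulfI.
  rewrite mulf_neq0 ?expfz_neq0 // => /(_ isT)/eqP.
  rewrite (eq_prim_root_expr prim_z) !modn_small ?(ltn_trans (ltn_ord _) lt_Mt) //.
  move=> /eqP/val_inj ->; congr (_, _); apply: val_inj.
  move: Zx Zy; rewrite !inE /= => /andP[_ /eqP ex] /andP[_ /eqP ey].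
  by rewrite (divn_eq x2 h) (divn_eq y2 h) ex ey; congr (_ + _)%N; case: exy.
have XZ x : x \in X -> [/\ x.1.1 \in Z, x.1.2 \in Z & x.2 \in Z].
  by case: x => [[x1 x2] x3]; rewrite !in_setX => /andP[/andP[]].
apply: (@card_le_inj _ _ _ _ re) => [x | x y].
  rewrite in_set => /andP[/XZ[Z1 Z2 Z3] /eqP en]; rewrite inE /re.
  rewrite (ZE _ Z1) (ZE _ Z2) (ZE _ Z3) /lam -en; apply/eqP.
  by rewrite !exprD; ring.
rewrite in_set => /andP[/XZ[Z1 Z2 Z3] _].
rewrite in_set => /andP[/XZ[Z1' Z2' Z3'] _] [e1 e2 e3].
case: x y Z1 Z2 Z3 Z1' Z2' Z3' e1 e2 e3 => [[x1 x2] x3] [[y1 y2] y3] /=.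
move=> Z1 Z2 Z3 Z1' Z2' Z3' e1 e2 e3.
by congr (_, _, _); apply: inj_Z => //; apply: val_inj.
Qed.

Lemma max_exp_le (I : Type) (r : seq I) (P : pred I) (F : I -> nat) k W :
    (0 ^ k <= W)%N -> (forall i, P i -> F i ^ k <= W)%N ->
  ((\max_(i <- r | P i) F i) ^ k <= W)%N.
Proof.
move=> W0 FW; apply: (big_ind (fun m => m ^ k <= W)%N) => // m n mW nW.
by rewrite /maxn; case: ifP.
Qed.

(** With [m] the largest count in a block, [D ^ k <= c * 24 ^ 3 * h ^ 12] and [h <= M] give the
    exponent [k + 3 * 12]. In real terms [m] is at most a constant times [M ^ (1 / 3 + 12 / k)]. *)
Lemma count_bound k : (0 < k)%N -> exists2 c : nat, (0 < c)%N &
  forall (p : nat) (g : int) (t : nat) (a K L : int) (M h : nat),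
    prime p -> t.-primitive_root (g%:~R : 'F_p) -> ~~ (p%:Z %| a)%Z ->
    (M < t)%N -> (0 < h <= M)%N -> (144 * h ^ 8 < p)%N ->
  exists2 m : nat, (m ^ (3 * k) <= c * M ^ (k + 36))%N &
    (expCongrCount p g a M K L <= (M.-1 %/ h).+1 * m)%N.
Proof.
move=> k_gt0; have [c c_gt0 hc] := divisors_bound k.
exists ((3 * 354) ^ k * (c * 24 ^ 3) ^ 3)%N.
  by rewrite muln_gt0 !expn_gt0 !muln_gt0 c_gt0.
move=> p g t a K L M h pr_p prim_g pa lt_Mt /andP[h_gt0 le_hM] lt_hp.
pose n0 := (24 ^ 3 * h ^ 12)%N.
pose D := (\max_(n < n0.+1 | (0 < n)%N) size (divisors n))%N.
have D_le : (D ^ k <= c * n0)%N.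
  apply: max_exp_le => [|n n_gt0]; first by rewrite exp0n.
  by apply: leq_trans (hc _ n_gt0) _; rewrite leq_mul2l -ltnS ltn_ord orbT.
have hD n : (0 < n <= 24 ^ 3 * h ^ 12 -> size (divisors n) <= D)%N.
  move=> /andP[n_gt0 le_n]; pose i : 'I_n0.+1 := Ordinal (le_n : (n < n0.+1)%N).
  exact: (@leq_bigmax_cond _ (fun i : 'I_n0.+1 => 0 < i)%N
    (fun i => size (divisors i)) i).
pose Z b := [set ij : 'I_M * 'I_M |
  ((L + ij.2.+1%:Z)%:~R == a%:~R * (g%:~R : 'F_p) ^ (K + ij.1.+1%:Z)) &
  (ij.2 %/ h)%N == b].
pose nb := (M.-1 %/ h).+1.
exists (\max_(b <- iota 0 nb) #|Z b|)%N; last first.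
  set m := (\max_(b <- _) _)%N; rewrite /expCongrCount.
  apply: (@leq_trans (size (iota 0 nb) * m)); last by rewrite size_iota.
  apply: (@card_le_fibres _ _ _ (fun ij : 'I_M * 'I_M => ij.2 %/ h)%N) =>
    [[i j] _|b b_nb].
    by rewrite mem_iota /= add0n ltnS leq_div2r //; have := ltn_ord j; lia.
  have : (#|Z b| <= m)%N by apply: leq_bigmax_seq b_nb isT.
  apply: leq_trans.
  by apply/subset_leq_card/subsetP => x; rewrite !inE.
apply: max_exp_le => [|b _]; first by rewrite exp0n // muln_gt0.
rewrite expnM; apply: (@leq_trans ((3 * M * (354 * D ^ 3)) ^ k)%N).
  by apply: leq_expn2r; apply: block_bound pr_p prim_g pa lt_Mt h_gt0 lt_hp hD.
rewrite (_ : 3 * M * (354 * D ^ 3) = 3 * 354 * (M * D ^ 3))%N; last by lia.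
rewrite expnMn -mulnA leq_mul2l; apply/orP; right.
rewrite (expnMn M) expnAC.
apply: (@leq_trans (M ^ k * (c * n0) ^ 3)%N).
  by rewrite leq_mul2l leq_expn2r ?orbT.
rewrite /n0 (mulnA c) (expnMn _ (h ^ 12)) mulnCA leq_mul2l; apply/orP; right.
by rewrite expnD leq_mul2l -expnM leq_expn2r ?orbT.
Qed.

(** * Choice of the block length and passage to real exponents *)

(** For the largest admissible [h], [p <= 144 (h + 1) ^ 8 <= 144 (2 h) ^ 8], and
    [144 * 2 ^ 8 <= 4 ^ 8]. The threshold 145 makes [h = 1] admissible. *)
Lemma exists_root8 p : (145 <= p)%N ->
  exists2 h : nat, (0 < h /\ 144 * h ^ 8 < p)%N & (p <= (4 * h) ^ 8)%N.
Proof.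
move=> p_ge.
have exP : exists n, (144 * n ^ 8 < p)%N by exists 1%N.
have leP n : (144 * n ^ 8 < p -> n <= p)%N.
  move=> lt_np; apply/ltnW/(leq_ltn_trans _ lt_np).
  by case: n {lt_np} => // n; rewrite expnS mulnCA leq_pmulr // muln_gt0 expn_gt0.
case: (ex_maxnP exP leP) => h lt_hp h_max.
have h_gt0 : (0 < h)%N by apply: (h_max 1%N); rewrite exp1n.
exists h => //; rewrite leqNgt; apply/negP => lt_4h.
suff: (h.+1 <= h)%N by rewrite ltnn.
apply: h_max; apply: leq_ltn_trans lt_4h.
apply: (@leq_trans (144 * (2 * h) ^ 8)%N).
  by rewrite leq_mul2l leq_expn2r // ltn_Pmull.
by rewrite !expnMn mulnA leq_mul2r; apply/orP; right; lia.
Qed.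

(** If [p] divided [a], a range of [y] containing a multiple of [p] would give [M] solutions, too
    many for small [eps] when [M] is large but below [p ^ (1 / 8)]; this is why that case is
    excluded. *)
Theorem corollary4 (R : realType) :
  exists p0 : nat, forall eps : R, 0 < eps ->
  exists2 c : R, 0 < c &
    forall (p : nat) (g : int) (t : nat) (a K L : int) (M : nat),
      prime p -> (p0 <= p)%N ->
      2 <= g -> t.-primitive_root (g%:~R : 'F_p) ->
      ~~ (p%:Z %| a)%Z ->
      (1 <= M < t)%N ->
      (expCongrCount p g a M K L)%:R <
        (1 + M%:R * p%:R `^ (- (1 / 8))) *
        (M%:R `^ (1 / 3) * (c * M%:R `^ eps)).
Proof.
exists 145%N => eps eps_gt0.
(* Chosen so that the loss [12 / k] in the exponent is below [eps]. *)
pose k := (Num.truncn (12 / eps)).+1.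
have k_gt : 12 / k%:R < eps.
  by rewrite ltr_pdivrMr // mulrC -ltr_pdivrMr // truncnS_gt.
have [c0 c0_gt0 hc] := count_bound (isT : 0 < k)%N.
(* The 8 comes from the number of blocks, and the 1 makes the final inequality strict. *)
exists (8 * c0%:R + 1) =>
    [|p g t a K L M pr_p p_ge g_ge2 prim_g pa /andP[M_gt0 lt_Mt]].
  by rewrite ltr_wpDl ?mulr_ge0.
have [H [H_gt0 lt_Hp] le_pH] := exists_root8 p_ge.
(* A single block is enough when [M <= H]. *)
pose h := minn M H.
have h_M : (0 < h <= M)%N by rewrite leq_min M_gt0 H_gt0 geq_minl.
have lt_hp : (144 * h ^ 8 < p)%N.
  by apply: leq_ltn_trans lt_Hp; rewrite leq_mul2l leq_expn2r ?geq_minr ?orbT.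
have [m m_le count_le] := hc p g t a K L M h pr_p prim_g pa lt_Mt h_M lt_hp.
set u := M%:R * _; set v := M%:R `^ _.
have M_ge1 : 1 <= M%:R :> R by rewrite ler1n.
have p_gt0 : 0 < p%:R :> R by rewrite ltr0n prime_gt0.
have u_ge0 : 0 <= u by rewrite mulr_ge0 // powR_ge0.
have nb_le : ((M.-1 %/ h).+1)%:R <= 8 * (1 + u).
  have [le_MH|lt_HM] := leqP M H.
    by rewrite /h (minn_idPl le_MH) divn_small ?prednK //; lra.
  have /minn_idPr eh := ltnW lt_HM; rewrite /h eh.
  have nbH : ((M.-1 %/ H).+1 * H <= 2 * M)%N.
    by rewrite mulSn; have := leq_divM M.-1 H; clear -M_gt0 lt_HM; lia.
  have H_gt0' : 0 < H%:R :> R by rewrite ltr0n.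
  have p8 : p%:R `^ (1 / 8) <= 4 * H%:R :> R.
    have e8 : 8%:R * (1 / 8) = 1 :> R by field.
    have -> : 4 * H%:R = (((4 * H) ^ 8)%N%:R : R) `^ (1 / 8).
      by rewrite natrX -powR_mulrn // -powRrM e8 powRr1 // natrM.
    by rewrite ge0_ler_powR ?nnegrE // ?ler_nat //; lra.
  have u_ge : M%:R / (4 * H%:R) <= u.
    by rewrite /u powRN ler_wpM2l // lef_pV2 // posrE ?powR_gt0 // mulr_gt0.
  (* There are at most [2 M / H] blocks, and [p ^ (1 / 8) <= 4 H]. *)
  apply: (@le_trans _ _ (8 * (M%:R / (4 * H%:R)))); last by lra.
  rewrite (_ : 8 * _ = (2 * M)%N%:R / H%:R); last first.
    by rewrite natrM; field; rewrite gt_eqF.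
  by rewrite ler_pdivlMr // -natrM ler_nat.
have m_le' : m%:R <= c0%:R * (v * M%:R `^ eps).
  have k0 : 0 < k%:R :> R by rewrite ltr0n.
  (* Taking [3 k]-th roots; [r <= 1] and [c0 >= 1] bound the root of [c0] by [c0]. *)
  pose r : R := (3 * k)%:R^-1.
  have r_ge0 : 0 <= r by rewrite invr_ge0.
  have r_le1 : r <= 1 by rewrite invf_le1 ?ltr0n ?ler1n.
  have -> : m%:R = ((m ^ (3 * k))%N%:R : R) `^ r.
    by rewrite natrX -powR_mulrn // -powRrM mulfV ?powRr1 // pnatr_eq0.
  apply: (@le_trans _ _ ((c0 * M ^ (k + 36))%N%:R `^ r)).
    by rewrite ge0_ler_powR ?nnegrE // ler_nat.
  rewrite natrM powRM // ler_pM ?powR_ge0 //.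
    by rewrite -[leRHS]powRr1 // ler_powR // ler1n.
  rewrite -powRD; last by rewrite (gt_eqF (lt_le_trans ltr01 M_ge1)) implybT.
  rewrite natrX -powR_mulrn // -powRrM ler_powR //.
  rewrite (_ : _ * r = 1 / 3 + 12 / k%:R) ?lerD2l ?(ltW k_gt) //.
  by rewrite /r natrM natrD; field; rewrite gt_eqF.
apply: (@le_lt_trans _ _ (8 * (1 + u) * (c0%:R * (v * M%:R `^ eps)))).
  apply: le_trans (_ : (((M.-1 %/ h).+1 * m)%N%:R) <= _); first by rewrite ler_nat.
  by rewrite natrM ler_pM.
have w_gt0 : 0 < (1 + u) * (v * M%:R `^ eps).
  by rewrite !mulr_gt0 ?powR_gt0 ?ltr0n // ltr_wpDr.
rewrite -subr_gt0; apply: lt_le_trans w_gt0 _; rewrite le_eqVlt; apply/orP; left.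
by apply/eqP; ring.
Qed.
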